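(* Let $d:\{0,1,2\}^*\to[0,1]$ satisfy $d(\lambda)=1$ and $d(\sigma)=\sum_{i=0}^2 d(\sigma^\frown i)$ for all $\sigma$, so that $\mu^*_d$ is a probability measure on $\mathcal{C}$. Define $\mathcal{T}_d(Q)=\mu_d^*(\{K\in\mathcal{C}: K\cap Q\neq\emptyset\})$ for closed $Q\subseteq\{0,1\}^{\mathbb{N}}$. Then $\mathcal{T}_d$ is a capacity. Moreover, if $d$ is computable, then $\mathcal{T}_d$ is a computable capacity.
   Context: $\mathcal{C}$ is the space of nonempty closed subsets of $\{0,1\}^{\mathbb{N}}$. For a nonempty closed $Q$, $T_Q=\{\sigma: Q\cap I(\sigma)\neq\emptyset\}$ where $I(\sigma)$ is the set of infinite sequences extending $\sigma$; enumerate $T_Q$ as $\sigma_0,\sigma_1,\ldots$ by length then lexicographically, and let $x_Q\in\{0,1,2\}^{\mathbb{N}}$ have $x_Q(n)=2$ if both $\sigma_n^\frown0,\sigma_n^\frown1\in T_Q$, $1$ if only $\sigma_n^\frown1\in T_Q$, $0$ if only $\sigma_n^\frown0\in T_Q$. $\mu_d$ is the Borel probability measure on $\{0,1,2\}^{\mathbb{N}}$ with $\mu_d(I(\sigma))=d(\sigma)$, and $\mu_d^*(\mathcal{X})=\mu_d(\{x_Q:Q\in\mathcal{X}\})$. A capacity is a function $\mathcal{T}$ from closed subsets of $\{0,1\}^{\mathbb{N}}$ to $[0,1]$ with $\mathcal{T}(\emptyset)=0$ such that (i) $Q_1\subseteq Q_2$ implies $\mathcal{T}(Q_1)\leq\mathcal{T}(Q_2)$;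 (ii) for $n\geq2$ and closed $Q_1,\dots,Q_n$, $\mathcal{T}(\bigcap_{i=1}^nQ_i)\leq\sum\{(-1)^{|I|+1}\mathcal{T}(\bigcup_{i\in I}Q_i):\emptyset\neq I\subseteq\{1,\dots,n\}\}$; (iii) if $Q_{n+1}\subseteq Q_n$ for all $n$ and $Q=\bigcap_nQ_n$ then $\mathcal{T}(Q)=\lim_n\mathcal{T}(Q_n)$. A capacity is computable if there is a computable function $F$ from the Boolean algebra of clopen subsets of $\{0,1\}^{\mathbb{N}}$ to $[0,1]$ with $F(B)=\mathcal{T}(B)$ for every clopen $B$. *)

(* Defs.v *)
From HB Require Import structures.
From mathcomp Require Import all_boot all_order all_algebra.
From mathcomp Require Import all_classical all_reals all_analysis.

Set Implicit Arguments.
Unset Strict Implicit.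
Unset Printing Implicit Defensive.

Import Order.TTheory GRing.Theory Num.Theory.
Import numFieldNormedType.Exports.

Local Open Scope classical_set_scope.
Local Open Scope ring_scope.

(* Total computable functions nat^k -> nat: the general recursive functions,
   i.e. the closure of the initial functions under composition, primitive
   recursion and minimization of regular (everywhere successful) searches. *)
Inductive recursive_fun : forall k : nat, (k.-tuple nat -> nat) -> Prop :=
| rec_zero (k : nat) : recursive_fun (fun _ : k.-tuple nat => 0%N)
| rec_succ : recursive_fun (fun v : 1.-tuple nat => (thead v).+1)
| rec_proj (k : nat) (i : 'I_k) :
    recursive_fun (fun v : k.-tuple nat => tnth v i)
| rec_comp (k m : nat) (f : m.-tuple nat -> nat)
      (g : 'I_m -> k.-tuple nat -> nat) :
    recursive_fun f -> (forall i, recursive_fun (g i)) ->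
    recursive_fun (fun v : k.-tuple nat => f [tuple g i v | i < m])
| rec_prim (k : nat) (f : k.-tuple nat -> nat) (g : k.+2.-tuple nat -> nat)
      (h : k.+1.-tuple nat -> nat) :
    recursive_fun f -> recursive_fun g ->
    (forall v : k.-tuple nat, h [tuple of 0%N :: v] = f v) ->
    (forall (n : nat) (v : k.-tuple nat),
       h [tuple of n.+1 :: v] = g [tuple of n :: h [tuple of n :: v] :: v]) ->
    recursive_fun h
| rec_min (k : nat) (f : k.+1.-tuple nat -> nat) (h : k.-tuple nat -> nat) :
    recursive_fun f ->
    (forall v : k.-tuple nat, f [tuple of h v :: v] = 0%N /\
       forall m : nat, (m < h v)%N -> f [tuple of m :: v] <> 0%N) ->
    recursive_fun h.

(* [f : W -> R] is computable with respect to the names [code : W -> nat]: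
   from a name of [w] and [n] one computes a rational within 2^-n of [f w]. *)
Definition computable_real_fun (R : realType) (W : Type) (code : W -> nat)
    (f : W -> R) : Prop :=
  exists p q r : 2.-tuple nat -> nat,
    [/\ recursive_fun p, recursive_fun q, recursive_fun r &
      forall (w : W) (n : nat), let v := [tuple code w; n] in
        `|f w - ((p v)%:R - (q v)%:R) / (r v).+1%:R| <= 2 ^- n].

Definition code_ternary_word (s : seq 'I_3) : nat :=
  CodeSeq.code [seq nat_of_ord i | i <- s].

Definition code_binary_word (s : seq bool) : nat :=
  CodeSeq.code [seq nat_of_bool b | b <- s].

Definition code_clopen_name (l : seq (seq bool)) : nat :=
  CodeSeq.code [seq code_binary_word s | s <- l].

HB.instance Definition _ := isPointed.Build 'I_3 ord0.

Definition ternary_space : Type :=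
  prod_topology (fun _ : nat => discrete_topology 'I_3).
HB.instance Definition _ := Pointed.on ternary_space.
HB.instance Definition _ := Nbhs.on ternary_space.
HB.instance Definition _ := Topological.on ternary_space.
HB.instance Definition _ := Uniform.on ternary_space.

Notation ternary_borel := (g_sigma_algebraType (@open ternary_space)).

Definition cylinder (A : Type) (s : seq A) : set (nat -> A) :=
  [set x | mkseq x (size s) = s].

(* Every clopen subset of the Cantor space is a finite union of cylinders. *)
Definition clopen_of_name (l : seq (seq bool)) : set cantor_space :=
  \bigcup_(s in [set` l]) (cylinder s : set cantor_space).

Definition closed_hyperspace : set (set cantor_space) :=
  [set Q | closed Q /\ Q !=set0].

Definition tree_of_closed (Q : set cantor_space) : set (seq bool) :=
  [set s | Q `&` (cylinder s : set cantor_space) !=set0].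

(* The words of length k, in lexicographic order. *)
Fixpoint binary_words (k : nat) : seq (seq bool) :=
  if k is k'.+1 then [seq b :: s | b <- [:: false; true], s <- binary_words k']
  else [:: [::]].

Definition tree_level (Q : set cantor_space) (k : nat) : seq (seq bool) :=
  [seq s <- binary_words k | `[< tree_of_closed Q s >]].

(* The n-th node of T_Q by length, then lexicographically. When Q is nonempty,
   every level of T_Q is nonempty, so levels 0..n contain this node. *)
Definition tree_node (Q : set cantor_space) (n : nat) : seq bool :=
  nth [::] (flatten [seq tree_level Q k | k <- iota 0 n.+1]) n.

(* x_Q; for closed nonempty Q, each node of T_Q has a child in T_Q, so the
   last branch means that only the left child is in T_Q. *)
Definition code_of_closed (Q : set cantor_space) : ternary_space := fun n =>
  let s := tree_node Q n in
  if `[< tree_of_closed Q (rcons s true) >] then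
    if `[< tree_of_closed Q (rcons s false) >] then inord 2 else inord 1
  else inord 0.

Section Capacity.
Variable R : realType.

Definition mu_star (mu : probability ternary_borel R)
    (X : set (set cantor_space)) : \bar R :=
  mu (code_of_closed @` X).

Definition hitting_capacity (mu : probability ternary_borel R)
    (Q : set cantor_space) : R :=
  fine (mu_star mu [set K | closed_hyperspace K /\ K `&` Q !=set0]).

(* Capacities are only constrained on closed sets. *)
Definition is_capacity (T : set cantor_space -> R) : Prop :=
  [/\ forall Q, closed Q -> 0 <= T Q <= 1,
      T set0 = 0,
      forall Q1 Q2, closed Q1 -> closed Q2 -> Q1 `<=` Q2 -> T Q1 <= T Q2,
      forall (n : nat) (Q : 'I_n -> set cantor_space), (2 <= n)%N ->
        (forall i, closed (Q i)) ->
        T (\bigcap_i Q i) <=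
          \sum_(I : {set 'I_n} | (0 < #|I|)%N)
            (-1) ^+ #|I|.+1 * T (\bigcup_(i in [set j | j \in I]) Q i) &
      forall Q : nat -> set cantor_space, (forall n, closed (Q n)) ->
        (forall n, Q n.+1 `<=` Q n) ->
        T (Q n) @[n --> \oo] --> T (\bigcap_n Q n)].

Definition is_computable_capacity (T : set cantor_space -> R) : Prop :=
  is_capacity T /\
  exists F : set cantor_space -> R,
    [/\ forall B, clopen B -> 0 <= F B <= 1,
        computable_real_fun code_clopen_name (F \o clopen_of_name) &
        forall B, clopen B -> F B = T B].

End Capacity.

(* Main.v *)
(* A closed set K meets a closed set Q iff, by compactness, at every level k the
   tree of K contains a node of the tree of Q. Level k of the tree of K is
   determined by the first 2^k symbols of x_K, and Q |-> x_Q is a bijection onto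
   the ternary sequences, so {x_K : K meets Q} is a decreasing intersection of
   clopen sets. Monotonicity, continuity along decreasing sequences (compactness
   again) and the alternating inequality (inclusion-exclusion for the events
   that K meets Q_i, whose intersection contains the event that K meets the
   intersection of the Q_i) are then properties of the measure.
   If Q is a finite union of cylinders of words of length at most m, then level m
   alone decides whether K meets Q, so the capacity of Q is a finite sum of values
   d(w) over words w of length 2^m; computing these words and adding rational
   approximations of d(w) is recursive. *)
Require Import Defs.
From HB Require Import structures.
From mathcomp Require Import all_boot all_order all_algebra.
From mathcomp Require Import all_classical all_reals all_analysis.
From mathcomp Require Import ring.

Set Implicit Arguments.
Unset Strict Implicit.
Unset Printing Implicit Defensive.

Import Order.TTheory GRing.Theory Num.Theory.
Import numFieldNormedType.Exports.

Local Open Scope classical_set_scope.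
Local Open Scope ring_scope.
Local Open Scope nat_scope.

(** * Recursive functions on coded types *)

Lemma recursive_ext k (f g : k.-tuple nat -> nat) :
  recursive_fun f -> f =1 g -> recursive_fun g.
Proof. by move=> rf /funext <-. Qed.

Definition recursive1 (f : nat -> nat) :=
  recursive_fun (fun v : 1.-tuple nat => f (tnth v ord0)).

Definition recursive2 (f : nat -> nat -> nat) :=
  recursive_fun (fun v : 2.-tuple nat =>
    f (tnth v ord0) (tnth v (lift ord0 ord0))).

Definition recursive3 (f : nat -> nat -> nat -> nat) :=
  recursive_fun (fun v : 3.-tuple nat =>
    f (tnth v ord0) (tnth v (lift ord0 ord0))
      (tnth v (lift ord0 (lift ord0 ord0)))).

Lemma recursive_comp1 k f (g : k.-tuple nat -> nat) :
  recursive1 f -> recursive_fun g -> recursive_fun (fun v => f (g v)).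
Proof.
move=> rf rg; apply: recursive_ext (rec_comp rf (fun _ : 'I_1 => rg)) _ => v.
by rewrite tnth_mktuple.
Qed.

Lemma recursive_comp2 k f (g h : k.-tuple nat -> nat) :
  recursive2 f -> recursive_fun g -> recursive_fun h ->
  recursive_fun (fun v => f (g v) (h v)).
Proof.
move=> rf rg rh; pose F (i : 'I_2) := if i == ord0 then g else h.
have rF i : recursive_fun (F i) by rewrite /F; case: ifP.
by apply: recursive_ext (rec_comp rf rF) _ => v; rewrite !tnth_mktuple.
Qed.

Lemma recursive_cst k c : recursive_fun (fun _ : k.-tuple nat => c).
Proof.
by elim: c => [|c IHc]; [exact: rec_zero | exact: recursive_comp1 rec_succ IHc].
Qed.

Lemma recursive_prim f g h :
  recursive1 f -> recursive3 g -> (forall a, h 0 a = f a) ->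
  (forall n a, h n.+1 a = g n (h n a) a) -> recursive2 h.
Proof.
move=> rf rg h0 hS; apply: (rec_prim rf rg) => [v|n v].
  by rewrite tnth0 tnthS h0.
by rewrite !tnth0 !tnthS ?tnth0 hS.
Qed.

Lemma recursive_search f h :
  recursive2 f -> (forall a, f (h a) a = 0) ->
  (forall a m, m < h a -> f m a <> 0) -> recursive1 h.
Proof.
move=> rf h0 hm; apply: (rec_min rf) => v; rewrite !tnth0 tnthS h0.
by split=> // m ltm; rewrite !tnth0 tnthS; exact: hm.
Qed.

Create HintDb recdb.
Local Hint Resolve rec_proj recursive_cst : recdb.
Local Ltac rec := rewrite /recursive1 /recursive2 /recursive3; eauto 20 with recdb.

(** This and the following closure lemmas take arbitrary argument functions, so that [rec] can
    decompose a compound expression from its head symbol. *)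
Lemma recursive_succ k (f : k.-tuple nat -> nat) :
  recursive_fun f -> recursive_fun (fun v => (f v).+1).
Proof. exact: recursive_comp1 rec_succ. Qed.
Local Hint Resolve recursive_succ : recdb.

Lemma recursive_add k (f g : k.-tuple nat -> nat) :
  recursive_fun f -> recursive_fun g -> recursive_fun (fun v => f v + g v).
Proof.
apply: recursive_comp2.
by apply: (@recursive_prim id (fun _ r _ => r.+1)) => //; rec.
Qed.
Local Hint Resolve recursive_add : recdb.

Lemma recursive_mul k (f g : k.-tuple nat -> nat) :
  recursive_fun f -> recursive_fun g -> recursive_fun (fun v => f v * g v).
Proof.
apply: recursive_comp2.
apply: (@recursive_prim (fun=> 0) (fun _ r a => a + r)) => //; rec.
Qed.
Local Hint Resolve recursive_mul : recdb.

Lemma recursive_pred k (f : k.-tuple nat -> nat) :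
  recursive_fun f -> recursive_fun (fun v => (f v).-1).
Proof.
(* [recursive_prim] yields functions with a parameter, hence the dummy second argument. *)
move=> rf; apply: (@recursive_comp2 _ (fun n _ => n.-1) _ _ _ rf rf).
by apply: (@recursive_prim (fun=> 0) (fun n _ _ => n)) => //; rec.
Qed.
Local Hint Resolve recursive_pred : recdb.

Lemma recursive_sub k (f g : k.-tuple nat -> nat) :
  recursive_fun f -> recursive_fun g -> recursive_fun (fun v => f v - g v).
Proof.
move=> rf rg; apply: (@recursive_comp2 _ (fun n a => a - n) _ _ _ rg rf).
apply: (@recursive_prim id (fun _ r _ => r.-1)); rec => *;
  by rewrite ?subn0 ?subnS.
Qed.
Local Hint Resolve recursive_sub : recdb.

Lemma recursive_expn2 k (f : k.-tuple nat -> nat) :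
  recursive_fun f -> recursive_fun (fun v => 2 ^ f v).
Proof.
move=> rf; apply: (@recursive_comp2 _ (fun n _ => 2 ^ n) _ _ _ rf rf).
apply: (@recursive_prim (fun=> 1) (fun _ r _ => r + r)); rec => n _.
by rewrite expnS mul2n addnn.
Qed.
Local Hint Resolve recursive_expn2 : recdb.

Lemma recursive_eq k (f g : k.-tuple nat -> nat) :
  recursive_fun f -> recursive_fun g ->
  recursive_fun (fun v => nat_of_bool (f v == g v)).
Proof.
move=> rf rg.
(* Both truncated differences vanish exactly when the values agree. *)
have : recursive_fun (fun v => 1 - ((f v - g v) + (g v - f v))) by rec.
move/recursive_ext; apply=> v; rewrite eqn_leq -!subn_eq0 -addn_eq0.
by case: (_ + _) => // n; rewrite subSS sub0n.
Qed.
Local Hint Resolve recursive_eq : recdb.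

Lemma recursive_cond k (c f g : k.-tuple nat -> nat) :
  recursive_fun c -> recursive_fun f -> recursive_fun g ->
  recursive_fun (fun v => if c v == 0 then f v else g v).
Proof.
move=> rc rf rg.
have : recursive_fun (fun v => (c v == 0) * f v + ((c v == 0) == 0 :> nat) * g v).
  by rec.
move/recursive_ext; apply=> v.
by case: eqP => _; rewrite mul1n mul0n ?addn0 ?add0n.
Qed.
Local Hint Resolve recursive_cond : recdb.

Lemma recursive_half k (f : k.-tuple nat -> nat) :
  recursive_fun f -> recursive_fun (fun v => (f v)./2).
Proof.
move=> rf; apply: (@recursive_comp2 _ (fun n _ => n./2) _ _ _ rf rf).
(* The recursion is [n.+1./2 = n - n./2]. *)
apply: (@recursive_prim (fun=> 0) (fun n r _ => n - r)); rec => n _.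
by rewrite /= uphalf_half -{3}(odd_double_half n) -addnn addnA addnK.
Qed.
Local Hint Resolve recursive_half : recdb.

Lemma recursive_div_expn2 k (f g : k.-tuple nat -> nat) :
  recursive_fun f -> recursive_fun g ->
  recursive_fun (fun v => f v %/ 2 ^ g v).
Proof.
move=> rf rg; apply: (@recursive_comp2 _ (fun n a => a %/ 2 ^ n) _ _ _ rg rf).
apply: (@recursive_prim id (fun _ r _ => r./2)); rec => *;
  by rewrite ?divn1 ?expnSr ?divnMA ?divn2.
Qed.
Local Hint Resolve recursive_div_expn2 : recdb.

Lemma recursive_logn2 k (f : k.-tuple nat -> nat) :
  recursive_fun f -> recursive_fun (fun v => logn 2 (f v)).
Proof.
apply: recursive_comp1.
(* [dv n a] tests whether 2^(n+1) divides a nonzero [a]; the valuation is the first [n] at which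
   this fails. For [a = 0] the search stops at once, in agreement with [logn 2 0 = 0]. *)
pose dv (n a : nat) := if a == 0 then 0 else (a %/ 2 ^ n.+1 * 2 ^ n.+1 == a : nat).
have dvE n a : dv n a = (n < logn 2 a).
  rewrite /dv; case: eqP => [->|/eqP]; first by rewrite logn0.
  by rewrite -lt0n => a_gt0; rewrite -dvdn_eq pfactor_dvdn.
apply: (@recursive_search dv); first by rewrite /dv; rec.
- by move=> a; rewrite dvE ltnn.
- by move=> a m ltm; rewrite dvE ltm.
Qed.
Local Hint Resolve recursive_logn2 : recdb.

(* [CodeSeq.code (a :: s) = code_pair a (CodeSeq.code s)], so pairs and lists
   share their constructor and destructors. *)
Definition code_pair a b := 2 ^ a * b.*2.+1.
Definition code_fst c := logn 2 c.
Definition code_snd c := (c %/ 2 ^ logn 2 c)./2.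

Lemma code_pairK1 a b : code_fst (code_pair a b) = a.
Proof.
rewrite /code_fst /code_pair lognM ?expn_gt0// pfactorK// logn_coprime ?addn0//.
by rewrite coprime2n /= odd_double.
Qed.

Lemma code_pairK2 a b : code_snd (code_pair a b) = b.
Proof.
have := code_pairK1 a b; rewrite /code_fst /code_snd => ->.
by rewrite /code_pair mulKn ?expn_gt0// /= uphalf_double.
Qed.

Lemma recursive_pair k (f g : k.-tuple nat -> nat) :
  recursive_fun f -> recursive_fun g ->
  recursive_fun (fun v => code_pair (f v) (g v)).
Proof.
move=> rf rg.
have : recursive_fun (fun v => 2 ^ f v * (g v + g v).+1) by rec.
by move/recursive_ext; apply=> v; rewrite addnn.
Qed.
Local Hint Resolve recursive_pair : recdb.

Lemma recursive_fst : recursive1 code_fst.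
Proof. by rewrite /code_fst; rec. Qed.

Lemma recursive_snd : recursive1 code_snd.
Proof. by rewrite /code_snd; rec. Qed.

(** * Effective maps between coded types *)

(** The instances are chosen so that [encode] is convertible to [code_ternary_word] on ternary words
    and to [code_clopen_name] on lists of binary words. *)
Class coded (X : Type) := encode : X -> nat.
#[global] Hint Mode coded ! : typeclass_instances.
Instance coded_nat : coded nat := id.
Instance coded_bool : coded bool := nat_of_bool.
Instance coded_ord n : coded 'I_n := @nat_of_ord n.
Instance coded_prod X Y {cX : coded X} {cY : coded Y} : coded (X * Y) :=
  fun p => code_pair (encode p.1) (encode p.2).
Instance coded_seq X {cX : coded X} : coded (seq X) :=
  fun s => CodeSeq.code [seq encode x | x <- s].

(* Not a [Definition], so that unification cannot unfold it and confuse pairs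
   with lists, whose codes are convertible. *)
Variant effective X Y {cX : coded X} {cY : coded Y} (f : X -> Y) : Prop :=
  Effective F of recursive1 F & forall x, F (encode x) = encode (f x).

Section Effective.
Context (X Y Z A : Type) {cX : coded X} {cY : coded Y} {cZ : coded Z}
  {cA : coded A}.

Lemma effective_id : effective (fun x : X => x).
Proof. by exists id => //; rec. Qed.

Lemma effective_cst (y : Y) : effective (fun _ : X => y).
Proof. by exists (fun=> encode y) => //; rec. Qed.

Lemma effective_comp (g : Y -> Z) (f : X -> Y) :
  effective g -> effective f -> effective (fun x => g (f x)).
Proof.
move=> [G rG GE] [F rF FE]; exists (G \o F) => [|x /=]; last by rewrite FE GE.
exact: recursive_comp1 rG rF.
Qed.

Lemma effective_pair (f : X -> Y) (g : X -> Z) :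
  effective f -> effective g -> effective (fun x => (f x, g x)).
Proof.
move=> [F rF FE] [G rG GE]; exists (fun n => code_pair (F n) (G n)) => [|x].
  by move: rF rG; rec.
by rewrite FE GE.
Qed.

Lemma effective_fst (f : X -> Y * Z) : effective f -> effective (fun x => (f x).1).
Proof.
move=> [F rF FE]; exists (code_fst \o F) => [|x /=].
  exact: recursive_comp1 recursive_fst rF.
by rewrite FE code_pairK1.
Qed.

Lemma effective_snd (f : X -> Y * Z) : effective f -> effective (fun x => (f x).2).
Proof.
move=> [F rF FE]; exists (code_snd \o F) => [|x /=].
  exact: recursive_comp1 recursive_snd rF.
by rewrite FE code_pairK2.
Qed.

Lemma effective_recursive2 (h : nat -> nat -> nat) (f g : X -> nat) :
  recursive2 h -> effective f -> effective g ->
  effective (fun x => h (f x) (g x)).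
Proof.
move=> rh [F rF FE] [G rG GE]; exists (fun n => h (F n) (G n)) => [|x].
  exact: recursive_comp2.
by rewrite FE GE.
Qed.

Lemma effective_encode (f : X -> Y) : effective f -> effective (fun x => encode (f x)).
Proof. by move=> [F rF FE]; exists F. Qed.

Lemma effective_eq (T : eqType) {cT : coded T} (f g : X -> T) :
  injective (@encode T _) -> effective f -> effective g ->
  effective (fun x => f x == g x).
Proof.
move=> inj_enc [F rF FE] [G rG GE].
exists (fun n => nat_of_bool (F n == G n)) => [|x]; first by move: rF rG; rec.
by rewrite FE GE (inj_eq inj_enc).
Qed.

Lemma effective_if (b : X -> bool) (f g : X -> Y) :
  effective b -> effective f -> effective g ->
  effective (fun x => if b x then f x else g x).
Proof.
move=> [B rB BE] [F rF FE] [G rG GE].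
exists (fun n => if B n == 0 then G n else F n) => [|x].
  by move: rB rF rG; rec.
by rewrite BE FE GE; case: (b x).
Qed.

Lemma effective_cons (f : X -> A) (g : X -> seq A) :
  effective f -> effective g -> effective (fun x => f x :: g x).
Proof.
move=> [F rF FE] [G rG GE].
exists (fun n => code_pair (F n) (G n)) => [|x]; first by move: rF rG; rec.
by rewrite FE GE.
Qed.

Lemma effective_case (l : X -> seq A) (f : X -> Y) (g : X -> A -> seq A -> Y) :
  effective l -> effective f ->
  effective (fun p : X * (A * seq A) => g p.1 p.2.1 p.2.2) ->
  effective (fun x => if l x is a :: s then g x a s else f x).
Proof.
move=> [L rL LE] [F rF FE] [G rG GE].
(* The empty sequence has code 0, and the code of a nonempty one is already the pair code of its
   head and tail. *)
exists (fun n => if L n == 0 then F n else G (code_pair n (L n))) => [|x].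
  apply: recursive_cond => //; apply: recursive_comp1 rG _.
  by move: rL; rec.
rewrite LE FE; case: (l x) => //= a s.
rewrite {1}/encode /= muln_eq0 expn_eq0 /=.
exact: (GE (x, (a, s))).
Qed.

Lemma effective_iter (n : X -> nat) (g : X -> Y -> Y) (f : X -> Y) :
  effective n -> effective (fun p : X * Y => g p.1 p.2) -> effective f ->
  effective (fun x => iter (n x) (g x) (f x)).
Proof.
move=> [N rN NE] [G rG GE] [F rF FE].
pose H k a := iter k (fun y => G (code_pair a y)) (F a).
exists (fun a => H (N a) a) => [|x].
  apply: (@recursive_comp2 _ H) => //; last exact: rec_proj.
  apply: (@recursive_prim F (fun _ y a => G (code_pair a y))) => //.
  by apply: recursive_comp1 rG _; rec.
rewrite NE /H; elim: (n x : nat) => //= k; rewrite /encode /= => ->.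
exact: (GE (x, _)).
Qed.

End Effective.

(** Gives an iteration bound for folds before the length itself is known to be computable. *)
Lemma leq_size_encode A {cA : coded A} (s : seq A) : size s <= encode s.
Proof.
rewrite /encode; elim: s => //= a s IHs.
apply: (@leq_trans (encode s).+1) => //.
by rewrite -[_.+1]mul1n leq_mul ?expn_gt0// ltnS -addnn leq_addr.
Qed.

Section EffectiveSeq.
Context (X Y A : Type) {cX : coded X} {cY : coded Y} {cA : coded A}.

(** The iterated step consumes one entry and is the identity once the list is exhausted, so any
    number of iterations that is at least the length gives the fold. *)
Lemma effective_foldl (g : X -> Y -> A -> Y) (f : X -> Y) (l : X -> seq A) :
  effective (fun p : X * Y * A => g p.1.1 p.1.2 p.2) -> effective f ->
  effective l -> effective (fun x => foldl (g x) (f x) (l x)).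
Proof.
move=> eg ef el.
pose step x (p : seq A * Y) : seq A * Y :=
  if p.1 is a :: s then (s, g x p.2 a) else p.
have stepE x k s y : size s <= k -> iter k (step x) (s, y) = ([::], foldl (g x) y s).
  elim: k s y => [|k IHk] [|a s] y //=; last by rewrite -iterS iterSr => /IHk ->.
  by move=> _; rewrite IHk.
have : effective (fun x => (iter (encode (l x)) (step x) (l x, f x)).2).
  apply/effective_snd/effective_iter; [exact: effective_encode| |exact: effective_pair].
  apply: (@effective_case _ _ _ _ _ _ (fun p : X * (seq A * Y) => p.2.1)
    snd (fun p a s => (s, g p.1 p.2.2 a))).
  - by apply/effective_fst/effective_snd/effective_id.
  - by apply/effective_snd/effective_id.
  - apply: effective_pair; first by apply/effective_snd/effective_snd/effective_id.
    apply: (effective_comp (f := fun q => (q.1.1, q.1.2.2, q.2.1)) eg).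
    by apply: effective_pair; [apply: effective_pair|];
      do ?(exact: effective_id || apply: effective_fst || apply: effective_snd).
by congr effective; apply/funext => x; rewrite stepE ?leq_size_encode.
Qed.
End EffectiveSeq.

Section EffectiveFoldr.
Context (X Y A : Type) {cX : coded X} {cY : coded Y} {cA : coded A}.

Lemma effective_rev (l : X -> seq A) : effective l -> effective (fun x => rev (l x)).
Proof.
move=> el; have : effective (fun x => foldl (fun s a => a :: s) [::] (l x)).
  apply: effective_foldl => //; last exact: effective_cst.
  by apply: effective_cons; do ?(exact: effective_id || apply: effective_fst || apply: effective_snd).
congr effective; apply/funext => x.
suff E s (r : seq A) : foldl (fun s a => a :: s) r s = catrev s r by rewrite E.
by elim: s r => //= a s IHs r; rewrite IHs.
Qed.

Lemma effective_foldr (g : X -> A -> Y -> Y) (f : X -> Y) (l : X -> seq A) :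
  effective (fun p : X * A * Y => g p.1.1 p.1.2 p.2) -> effective f ->
  effective l -> effective (fun x => foldr (g x) (f x) (l x)).
Proof.
move=> eg ef el.
have : effective (fun x => foldl (fun y a => g x a y) (f x) (rev (l x))).
  apply: effective_foldl => //; last exact: effective_rev.
  apply: (effective_comp (f := fun q => (q.1.1, q.2, q.1.2)) eg).
  by apply: effective_pair; [apply: effective_pair|];
    do ?(exact: effective_id || apply: effective_fst || apply: effective_snd).
by congr effective; apply/funext => x; rewrite foldl_rev.
Qed.
End EffectiveFoldr.

Ltac eff_step := cbv beta; first
  [ exact: effective_id | exact: effective_cst | assumption
  | apply: effective_fst | apply: effective_snd | apply: effective_pair
  | apply: effective_if | apply: effective_cons | apply: effective_iter
  | apply: effective_foldr ].
Ltac eff := repeat eff_step.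

Section EffectiveNat.
Context (X : Type) {cX : coded X}.

Lemma effective_add (f g : X -> nat) :
  effective f -> effective g -> effective (fun x => f x + g x).
Proof.
by apply: effective_recursive2; apply: recursive_add; exact: rec_proj.
Qed.

Lemma effective_mul (f g : X -> nat) :
  effective f -> effective g -> effective (fun x => f x * g x).
Proof.
by apply: effective_recursive2; apply: recursive_mul; exact: rec_proj.
Qed.

Lemma effective_succ (f : X -> nat) : effective f -> effective (fun x => (f x).+1).
Proof.
move=> ef; apply: (@effective_recursive2 _ _ (fun n _ => n.+1) f f) => //.
by apply: recursive_succ; exact: rec_proj.
Qed.

Lemma effective_pred (f : X -> nat) : effective f -> effective (fun x => (f x).-1).
Proof.
move=> ef; apply: (@effective_recursive2 _ _ (fun n _ => n.-1) f f) => //.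
by apply: recursive_pred; exact: rec_proj.
Qed.

Lemma effective_expn2 (f : X -> nat) : effective f -> effective (fun x => 2 ^ f x).
Proof.
move=> ef; apply: (@effective_recursive2 _ _ (fun n _ => 2 ^ n) f f) => //.
by apply: recursive_expn2; exact: rec_proj.
Qed.

End EffectiveNat.

Section EffectiveMap.
Context (X A B : Type) {cX : coded X} {cA : coded A} {cB : coded B}.

Lemma effective_map (g : X -> A -> B) (l : X -> seq A) :
  effective (fun p : X * A => g p.1 p.2) -> effective l ->
  effective (fun x => [seq g x a | a <- l x]).
Proof.
move=> eg el.
have : effective (fun x => foldr (fun a s => g x a :: s) [::] (l x)).
  by eff; apply: (effective_comp (f := fun q => (q.1.1, q.1.2)) eg); eff.
by congr effective; apply/funext => x; elim: (l x) => //= a s ->.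
Qed.

Lemma effective_filter (g : X -> A -> bool) (l : X -> seq A) :
  effective (fun p : X * A => g p.1 p.2) -> effective l ->
  effective (fun x => [seq a <- l x | g x a]).
Proof.
move=> eg el.
have : effective (fun x => foldr (fun a s => if g x a then a :: s else s) [::] (l x)).
  by eff; apply: (effective_comp (f := fun q => (q.1.1, q.1.2)) eg); eff.
by congr effective; apply/funext => x; elim: (l x) => //= a s ->.
Qed.

Lemma effective_has (g : X -> A -> bool) (l : X -> seq A) :
  effective (fun p : X * A => g p.1 p.2) -> effective l ->
  effective (fun x => has (g x) (l x)).
Proof.
move=> eg el.
have : effective (fun x => foldr (fun a s => if g x a then true else s) false (l x)).
  by eff; apply: (effective_comp (f := fun q => (q.1.1, q.1.2)) eg); eff.
by congr effective; apply/funext => x; elim: (l x) => //= a s ->.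
Qed.

Lemma effective_size (l : X -> seq A) : effective l -> effective (fun x => size (l x)).
Proof.
move=> el; have : effective (fun x => foldr (fun a n => n.+1) 0 (l x)).
  by eff; apply: effective_succ; eff.
by congr effective; apply/funext => x; elim: (l x) => //= a s ->.
Qed.

Lemma effective_cat (f g : X -> seq A) :
  effective f -> effective g -> effective (fun x => f x ++ g x).
Proof.
move=> ef eg; have : effective (fun x => foldr cons (g x) (f x)) by eff.
by congr effective; apply/funext => x; elim: (f x) => //= a s ->.
Qed.

End EffectiveMap.

Section EffectiveRcons.
Context (X A : Type) {cX : coded X} {cA : coded A}.

Lemma effective_rcons (f : X -> A) (l : X -> seq A) :
  effective f -> effective l -> effective (fun x => rcons (l x) (f x)).
Proof.
move=> ef el; have : effective (fun x => l x ++ [:: f x]).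
  by apply: effective_cat; eff.
by congr effective; apply/funext => x; rewrite cats1.
Qed.

Lemma effective_behead (l : X -> seq A) :
  effective l -> effective (fun x => behead (l x)).
Proof. by move=> el; apply: (@effective_case _ _ _ _ _ _ l (fun=> [::])); eff. Qed.

End EffectiveRcons.

Section EffectiveNth.
Context (X A : Type) {cX : coded X} {cA : coded A}.

Lemma effective_nth (d : X -> A) (l : X -> seq A) (i : X -> nat) :
  effective d -> effective l -> effective i ->
  effective (fun x => nth (d x) (l x) (i x)).
Proof.
move=> ed el ei.
have : effective (fun x => if iter (i x) behead (l x) is a :: _ then a else d x).
  by apply: effective_case; eff; apply: effective_behead; eff.
congr effective; apply/funext => x.
by elim: (i x) (l x) => [|n IHn] [|a s] //=; rewrite -iterS iterSr IHn // nth_nil.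
Qed.

Lemma effective_iota (n : X -> nat) : effective n -> effective (fun x => iota 0 (n x)).
Proof.
(* Each pass appends the current length. *)
move=> en; have : effective (fun x => iter (n x) (fun s => rcons s (size s)) [::]).
  by eff; apply: effective_rcons; eff; apply: effective_size; eff.
congr effective; apply/funext => x; elim: (n x) => // k.
by rewrite iterS => ->; rewrite size_iota -cats1 -addn1 iotaD.
Qed.

End EffectiveNth.

Lemma effective_flatten X A {cX : coded X} {cA : coded A} (l : X -> seq (seq A)) :
  effective l -> effective (fun x => flatten (l x)).
Proof.
move=> el; have : effective (fun x => foldr cat [::] (l x)).
  by eff; apply: effective_cat; eff.
by congr effective; apply/funext => x; elim: (l x) => //= a s ->.
Qed.

Lemma effective_recursive_fun X {cX : coded X} (p : 2.-tuple nat -> nat)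
    (f g : X -> nat) :
  recursive_fun p -> effective f -> effective g ->
  effective (fun x => p [tuple f x; g x]).
Proof.
move=> rp; apply: (@effective_recursive2 _ _ (fun a b => p [tuple a; b])).
apply: recursive_ext rp _ => v; congr p; apply: eq_from_tnth => i.
by case: (unliftP ord0 i) => [j ->|->]; rewrite ?tnth0// tnthS (ord1 j) tnth0.
Qed.

(** * The tree coded by a ternary sequence *)

(** [binary_words] grows words at the front, trees grow them at the end; in lexicographic order both
    give the same list. *)
Lemma binary_words_rcons k : binary_words k.+1 =
  flatten [seq [:: rcons s false; rcons s true] | s <- binary_words k].
Proof.
elim: k => [//|k IHk]; pose F s := [:: rcons s false; rcons s true].
have cons_flatten b : [seq b :: s | s <- binary_words k.+1] =
    flatten [seq F s | s <- [seq b :: s | s <- binary_words k]].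
  by rewrite IHk map_flatten -!map_comp.
have wordsE j : binary_words j.+1 =
    [seq false :: s | s <- binary_words j] ++ [seq true :: s | s <- binary_words j].
  by rewrite /= cats0.
by rewrite wordsE !cons_flatten [in RHS]wordsE map_cat flatten_cat.
Qed.

Lemma mem_binary_words k s : (s \in binary_words k) = (size s == k).
Proof.
elim: k s => [|k IHk] s; first by rewrite inE; case: s.
rewrite /= cats0 mem_cat; case: s => [|b s] /=.
  by apply/negbTE/negP => /orP[] /mapP[].
have memE c : (b :: s \in [seq c :: t | t <- binary_words k]) =
    (b == c) && (s \in binary_words k).
  by apply/mapP/andP => [[t tw [-> ->]]|[/eqP-> sw]]; [|exists s].
by rewrite eqSS -IHk !memE; case: b {memE} => /=; rewrite ?orbF.
Qed.

Lemma binary_words_uniq k : uniq (binary_words k).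
Proof.
elim: k => //= k IHk; have inj b : injective (cons b : seq bool -> _) by move=> ? ? [].
rewrite cats0 cat_uniq !map_inj_uniq ?IHk//; try exact: inj.
by rewrite andbT /=; apply/hasPn => _ /mapP[s _ ->]; apply/negP => /mapP[].
Qed.

(** For a prefix-closed [P], discarding nodes before passing to children loses nothing. This gives
    [tree_level] the same shape of recursion as [level]. *)
Lemma filter_binary_words (P : pred (seq bool)) k :
  (forall s b, P (rcons s b) -> P s) ->
  [seq s <- binary_words k.+1 | P s] =
  flatten [seq [seq t <- [:: rcons s false; rcons s true] | P t]
          | s <- [seq s <- binary_words k | P s]].
Proof.
move=> Pcl; rewrite binary_words_rcons; elim: (binary_words k) => //= s w ->.
case: (boolP (P s)) => [Ps|/negP Ps] //=; first by do 2 case: (P (rcons _ _)).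
by do 2 (case: ifP => [/Pcl//|_]).
Qed.

(** Decodes the three-way choice made in [code_of_closed]. *)
Definition branches (c : 'I_3) (s : seq bool) : seq (seq bool) :=
  if c == 2 :> nat then [:: rcons s false; rcons s true]
  else if c == 1 :> nat then [:: rcons s true] else [:: rcons s false].

Definition level_step (x : nat -> 'I_3) (p : nat * seq (seq bool)) :=
  (p.1 + size p.2,
   flatten [seq branches (x (p.1 + i)) (nth [::] p.2 i) | i <- iota 0 (size p.2)]).

(* Level [k] of the tree coded by [x], with the position in [x] of the symbol
   attached to its first node. *)
Definition level_state (x : nat -> 'I_3) (k : nat) : nat * seq (seq bool) :=
  iter k (level_step x) (0, [:: [::]]).
Definition offset x k := (level_state x k).1.
Definition level x k := (level_state x k).2.

Lemma offsetS x k : offset x k.+1 = offset x k + size (level x k).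
Proof. by rewrite /offset /level_state iterS. Qed.

Lemma levelS x k : level x k.+1 = flatten
  [seq branches (x (offset x k + i)) (nth [::] (level x k) i)
  | i <- iota 0 (size (level x k))].
Proof. by rewrite /level /level_state iterS. Qed.

Lemma branches_subseq c s :
  subseq (branches c s) [:: rcons s false; rcons s true].
Proof.
rewrite /branches; case: ifP => _ //; case: ifP => _; rewrite ?sub1seq.
  by rewrite !inE eqxx orbT.
by rewrite !inE eqxx.
Qed.

Lemma size_branches c s : 0 < size (branches c s) <= 2.
Proof. by rewrite /branches; do ?case: ifP. Qed.

Lemma mem_branches c s t : t \in branches c s -> exists b, t = rcons s b.
Proof.
move/(mem_subseq (branches_subseq c s)); rewrite !inE => /orP[] /eqP ->;
  by [exists false|exists true].
Qed.

Lemma subseq_flatten_map (S T : eqType) (F : S -> seq T) (s1 s2 : seq S) :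
  subseq s1 s2 -> subseq (flatten (map F s1)) (flatten (map F s2)).
Proof.
elim: s2 s1 => [|y s2 IHs] [|x s1] // sub; first exact: sub0seq.
move: sub; rewrite /=; case: eqP => [-> /IHs sub|_ /IHs sub].
  exact: cat_subseq.
exact: subseq_trans sub (suffix_subseq _ _).
Qed.

(** Carries the order, the absence of repetitions and the word length all at once. *)
Lemma level_subseq x k : subseq (level x k) (binary_words k).
Proof.
elim: k => // k IHk; rewrite levelS binary_words_rcons.
apply: (@subseq_trans _ (flatten [seq [:: rcons s false; rcons s true] | s <- level x k])).
  rewrite -[in X in subseq _ X](mkseq_nth [::] (level x k)) /mkseq -map_comp.
  elim: (iota _ _) => // i l IHl; exact: cat_subseq (branches_subseq _ _) IHl.
exact: subseq_flatten_map.
Qed.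

Lemma level_uniq x k : uniq (level x k).
Proof. exact: subseq_uniq (level_subseq x k) (binary_words_uniq k). Qed.

Lemma level_words x k s : s \in level x k -> size s = k.
Proof. by move/(mem_subseq (level_subseq x k)); rewrite mem_binary_words => /eqP. Qed.

(** A level has no repetitions, so the index of [s] is unique and a single symbol of [x] decides
    which children of [s] are present. *)
Lemma mem_levelS x k s b i : i < size (level x k) -> nth [::] (level x k) i = s ->
  (rcons s b \in level x k.+1) = (rcons s b \in branches (x (offset x k + i)) s).
Proof.
move=> ltik si; rewrite levelS; apply/flatten_mapP/idP => [[j]|sb].
  rewrite mem_iota add0n => /= ltjk jb; have [c] := mem_branches jb.
  move/eqP; rewrite eqseq_rcons => /andP[/eqP sj _]; move: jb; rewrite -sj.
  have -> // : j = i.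
  by apply/eqP; rewrite -(nth_uniq [::] _ _ (level_uniq x k))// si sj.
by exists i; rewrite ?si// mem_iota add0n.
Qed.

Lemma level_rcons x k s b : rcons s b \in level x k.+1 -> s \in level x k.
Proof.
rewrite levelS => /flatten_mapP[i]; rewrite mem_iota add0n => /= ltik.
move=> /mem_branches[c /eqP]; rewrite eqseq_rcons => /andP[/eqP -> _].
exact: mem_nth.
Qed.

(** No symbol codes a dead end: [branches] is never empty. *)
Lemma level_extend x k s : s \in level x k -> exists b, rcons s b \in level x k.+1.
Proof.
move=> sk; have ltik : index s (level x k) < size (level x k) by rewrite index_mem.
have sE := mem_levelS _ ltik (nth_index _ sk).
have := size_branches (x (offset x k + index s (level x k))) s.
case E : branches => [|t l] // _; have tb : t \in t :: l by rewrite mem_head.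
rewrite -E in tb; have [b tE] := mem_branches tb.
by exists b; rewrite sE -tE.
Qed.

Lemma size_level x k : 0 < size (level x k) <= 2 ^ k.
Proof.
elim: k => // k IHk; apply/andP; split.
  case E : (level x k) => [|s l]; first by rewrite E in IHk.
  have : s \in level x k by rewrite E mem_head.
  by move/level_extend => [b]; case: (level x k.+1).
case/andP: IHk => _; rewrite expnS mulnC; move: (size_branches) => szb.
rewrite -(leq_pmul2r (isT : 0 < 2)); apply: leq_trans; rewrite levelS.
rewrite -{2}(size_iota 0 (size (level x k))).
elim: (iota _ _) => //= i l IHl; rewrite size_cat mulSn leq_add//.
by case/andP: (szb (x (offset x k + i)) (nth [::] (level x k) i)).
Qed.

(** The levels before [k] have at most 1 + 2 + ... + 2^(k-1) = 2^k - 1 nodes. *)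
Lemma offset_bound x k : offset x k < 2 ^ k.
Proof.
elim: k => // k IHk; rewrite offsetS expnS mul2n -addnn.
by rewrite -addSn leq_add//; case/andP: (size_level x k).
Qed.

(** Building level [k] reads one symbol per node of the earlier levels, all at positions below
    2^k. *)
Lemma eq_level x y k : (forall i, i < 2 ^ k -> x i = y i) ->
  level_state x k = level_state y k.
Proof.
elim: k => // k IHk xy; have IH : level_state x k = level_state y k.
  by apply: IHk => i lti; apply: xy; rewrite (leq_trans lti)// leq_exp2l.
rewrite /level_state !iterS -!/(level_state _ _) -IH /level_step.
congr (_, flatten _); apply/eq_in_map => i; rewrite mem_iota add0n => /= lti.
congr branches; apply: xy; rewrite -/(level x k) -/(offset x k) in lti *.
rewrite expnS mul2n -addnn -addSn leq_add ?offset_bound//.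
by rewrite (leq_trans (ltnW lti))//; case/andP: (size_level x k).
Qed.

Section Concatenation.
Variables (L : nat -> seq (seq bool)) (o : nat -> nat).
Hypotheses (L_gt0 : forall k, 0 < size (L k)) (o0 : o 0 = 0)
  (oS : forall k, o k.+1 = o k + size (L k)).

(** Since no level is empty, [k <= o k], so the truncated concatenation in [tree_node] already
    contains level [k]. The levels are abstract because both [level x] and [tree_level Q] are
    substituted for [L]. *)
Lemma nth_flatten_levels k i : i < size (L k) ->
  nth [::] (flatten [seq L j | j <- iota 0 (o k + i).+1]) (o k + i) = nth [::] (L k) i.
Proof.
move=> ltik; have kok j : j <= o j.
  by elim: j => // j IHj; rewrite oS -addn1 leq_add.
have sz j : size (flatten [seq L j | j <- iota 0 j]) = o j.
  elim: j => // j IHj.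
  by rewrite -addn1 iotaD map_cat flatten_cat size_cat IHj /= cats0 addn1 oS.
have kn : k < (o k + i).+1 by rewrite ltnS (leq_trans (kok k)) ?leq_addr.
rewrite -(subnKC kn) -addn1 -addnA iotaD map_cat flatten_cat nth_cat sz.
by rewrite ltnNge leq_addr /= addKn nth_cat ltik.
Qed.

Lemma locate_level n : exists k i, i < size (L k) /\ n = o k + i.
Proof.
elim: n => [|n [k [i [ltik ->]]]]; first by exists 0, 0; rewrite o0.
have [ltik'|geik] := ltnP i.+1 (size (L k)).
  by exists k, i.+1; rewrite addnS.
exists k.+1, 0; split=> //; rewrite oS addn0 -addnS; congr (_ + _).
by apply/eqP; rewrite eqn_leq ltik geik.
Qed.
End Concatenation.

(** * Prefix sets and compactness *)

Lemma open_cylinder (T : pointedType) (s : seq T) :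
  open (cylinder s : set (prod_topology (fun _ : nat => discrete_topology T))).
Proof.
pose X := prod_topology (fun _ : nat => discrete_topology T).
elim/last_ind: s => [|s b IHs].
  by rewrite (_ : cylinder _ = setT) ?eqEsubset//; exact: openT.
have -> : cylinder (rcons s b) =
    (cylinder s : set X) `&` (proj (size s) : X -> discrete_topology T) @^-1` [set b].
  rewrite /cylinder /proj; apply/seteqP; split => x /=; rewrite size_rcons mkseqS.
    by move=> /rcons_inj[-> ->].
  by move=> [-> ->].
apply: openI; first exact: IHs.
apply: open_comp => [x _|]; first exact: proj_continuous.
exact: discrete_open.
Qed.

Section PrefixSets.
Context (T : pointedType).
Local Notation X := (prod_topology (fun _ : nat => discrete_topology T)).

(** A union of cylinders; the complement has the same form, so prefix sets are clopen. *)
Lemma open_prefix (S : set (seq T)) k : open [set y : X | S (mkseq y k)].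
Proof.
have -> : [set y : X | S (mkseq y k)] =
    \bigcup_(s in [set s | S s /\ size s = k]) cylinder s.
  apply/seteqP; split => [y Sy|y [s [Ss <-]] ys].
    exists (mkseq y k); first by rewrite /= size_mkseq.
    by rewrite /cylinder /= size_mkseq.
  by move: Ss; rewrite -{1}ys.
by apply: bigcup_open => s _; exact: open_cylinder.
Qed.

Lemma closed_prefix (S : set (seq T)) k : closed [set y : X | S (mkseq y k)].
Proof. by rewrite -openC; exact: (open_prefix (~` S)). Qed.
End PrefixSets.

(** Choose a point in each set: a cluster point of this sequence lies in every [F n], because the
    sequence stays in [F n] from index [n] on. *)
Lemma cantor_nested (F : nat -> set cantor_space) :
  (forall n, closed (F n)) -> (forall n, F n.+1 `<=` F n) ->
  (forall n, F n !=set0) -> \bigcap_n F n !=set0.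
Proof.
move=> clF decF neF; pose y n := projT1 (cid (neF n)).
have Fy n : F n (y n) by rewrite /y; case: cid.
have subF m n : m <= n -> F n `<=` F m.
  by move/subnK <-; elim: (n - m) => // k IHk; exact: subset_trans (decF _) IHk.
have [p [_ clp]] := @cantor_space_compact (y @ \oo) _ filterT.
exists p => n _; apply: clF => B Bp; apply: clp => //.
by exists n => // m /= /subF; apply.
Qed.

Lemma tree_mkseq Q (y : cantor_space) k : Q y -> tree_of_closed Q (mkseq y k).
Proof. by move=> Qy; exists y; split=> //; rewrite /cylinder /= size_mkseq. Qed.

Lemma tree_rcons Q s b : tree_of_closed Q (rcons s b) -> tree_of_closed Q s.
Proof.
move=> [y [Qy]]; rewrite /cylinder /= size_rcons mkseqS => /rcons_inj[ys _].
by exists y.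
Qed.

Lemma tree_extend Q s : tree_of_closed Q s -> exists b, tree_of_closed Q (rcons s b).
Proof.
move=> [y [Qy ys]]; exists (y (size s)), y; split=> //.
by rewrite /cylinder /= size_rcons mkseqS ys.
Qed.

(** The traces of [Q] on the cylinders around [y] are nested, closed and nonempty, and [y] is the
    only point common to all these cylinders. *)
Lemma mem_closed_tree Q (y : cantor_space) : closed Q ->
  (forall k, tree_of_closed Q (mkseq y k)) -> Q y.
Proof.
move=> clQ Qy; pose F n := Q `&` [set z | mkseq z n = mkseq y n].
have [n|n z [Qz]|n|z zF] := @cantor_nested F.
- by apply: closedI => //; exact: (@closed_prefix bool [set s | s = mkseq y n]).
- by rewrite /= !mkseqS => /rcons_inj[].
- have [z [Qz]] := Qy n; rewrite /cylinder /= size_mkseq => zn.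
  by exists z.
suff <- : z = y by have [] := zF 0 I.
apply/funext => n; have [_] := zF n.+1 I.
by rewrite /= !mkseqS => /rcons_inj[].
Qed.

(** * The bijection between closed sets and ternary sequences *)

(** The inverse of [code_of_closed]: the infinite paths through the tree coded by [x]. *)
Definition branch_set (x : nat -> 'I_3) : set cantor_space :=
  [set y | forall k, mkseq y k \in level x k].

Lemma closed_branch_set x : closed (branch_set x).
Proof.
have -> : branch_set x = \bigcap_k [set y : cantor_space | mkseq y k \in level x k].
  by apply/seteqP; split => y yx k *; exact: yx.
by apply: closed_bigI => k _; exact: (@closed_prefix bool [set` level x k]).
Qed.

(** For the converse, a node is prolonged to an infinite path, which is possible as the tree has no
    leaves. *)
Lemma tree_branch_set x s : tree_of_closed (branch_set x) s <-> s \in level x (size s).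
Proof.
split=> [[y [yx ys]]|sx]; first by have := yx (size s); rewrite ys.
(* The appended letter is the truth value of the membership of the right child: go right if
   possible, otherwise left. *)
pose next t := rcons t (rcons t true \in level x (size t).+1).
have nextP t : t \in level x (size t) -> next t \in level x (size t).+1.
  move=> /level_extend[b]; rewrite /next; case: (boolP (rcons t true \in _)) => //.
  by case: b => // /negP.
pose w n := iter n next s.
have size_w n : size (w n) = size s + n.
  elim: n => [|n IHn]; first by rewrite addn0.
  by rewrite /w iterS size_rcons IHn addnS.
have wx n : w n \in level x (size s + n).
  elim: n => [|n IHn]; first by rewrite addn0.
  by rewrite addnS -size_w; apply: nextP; rewrite size_w.
(* [w n.+1] has more than [n] letters, so the default is not reached. *)
pose y n := nth false (w n.+1) n.
have ext i j k : i <= j -> k < size (w i) -> nth false (w j) k = nth false (w i) k.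
  move=> /subnK <- lti; elim: (j - i) => // l IHl.
  rewrite addSn /w iterS -/(w _) nth_rcons IHl size_w.
  by rewrite (leq_trans lti)// size_w leq_add2l leq_addl.
have wy n : mkseq y (size s + n) = w n.
  apply: (@eq_from_nth _ false) => [|k]; rewrite size_mkseq ?size_w// => ltk.
  rewrite nth_mkseq// /y -(ext k.+1 (maxn n k.+1)) ?leq_maxr//.
    by rewrite (ext n) ?leq_maxl// size_w.
  by rewrite size_w addnS ltnS leq_addl.
exists y; split; last by rewrite /cylinder /= -[size s]addn0 wy.
(* Prefixes shorter than [s] are in the tree by downward closure. *)
move=> k; have [/subnKC <-|/ltnW lek] := leqP (size s) k; first by rewrite wy.
have : mkseq y (size s) \in level x (size s) by rewrite -[size s]addn0 wy addn0.
move: lek => /subnK <-; elim: (size s - k) => // n IHn.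
by rewrite addSn mkseqS => /level_rcons.
Qed.

Lemma tree_level_branch_set x k : tree_level (branch_set x) k = level x k.
Proof.
rewrite [RHS](subseq_uniqP (binary_words_uniq k) (level_subseq x k)).
apply: eq_in_filter => s; rewrite mem_binary_words => /eqP <-.
by apply/asboolP/idP => /tree_branch_set.
Qed.

(** Surjectivity of the coding. If the [n]-th node is entry [i] of level [k], the symbol that
    produced its children sits at [offset x k + i = n], and those children determine the symbol. *)
Lemma code_branch_set x : code_of_closed (branch_set x) = x.
Proof.
have L_gt0 k : 0 < size (level x k) by case/andP: (size_level x k).
apply/funext => n; have [k [i [ltik nE]]] := locate_level L_gt0 erefl (offsetS x) n.
rewrite /code_of_closed; set s := tree_node _ _.
have sE : s = nth [::] (level x k) i.
  rewrite -(nth_flatten_levels L_gt0 erefl (offsetS x) ltik) -nE /s /tree_node.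
  by congr (nth _ (flatten _) _); apply: eq_map => j; exact: tree_level_branch_set.
have treeE b : `[< tree_of_closed (branch_set x) (rcons s b) >] =
    (rcons s b \in branches (x n) s).
  rewrite nE -(mem_levelS _ ltik (esym sE)).
  have <- : size (rcons s b) = k.+1.
    by rewrite size_rcons sE (level_words (mem_nth _ ltik)).
  by apply/asboolP/idP => /tree_branch_set.
rewrite /= !treeE /branches; case: (x n) => [[|[|[|m]]] //= ltm];
  rewrite !inE ?eqseq_rcons ?eqxx /= ?andbF /=;
  by apply: val_inj; rewrite /= ?inordK.
Qed.

(** The induction must carry the offsets along with the levels, since they locate the symbols used
    at the next level. *)
Lemma level_code Q : closed_hyperspace Q ->
  forall k, level (code_of_closed Q) k = tree_level Q k.
Proof.
move=> [clQ [y Qy]]; set x := code_of_closed Q.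
have L_gt0 k : 0 < size (tree_level Q k).
  have : mkseq y k \in tree_level Q k.
    rewrite mem_filter mem_binary_words size_mkseq eqxx andbT.
    by apply/asboolP; exact: tree_mkseq.
  by case: (tree_level Q k).
pose o k := size (flatten [seq tree_level Q j | j <- iota 0 k]).
have oS k : o k.+1 = o k + size (tree_level Q k).
  by rewrite /o -addn1 iotaD map_cat flatten_cat size_cat /= cats0 add0n.
suff lvl k : level x k = tree_level Q k /\ offset x k = o k.
  by move=> k; case: (lvl k).
elim: k => [|k [IHl IHo]].
  split=> //; rewrite /tree_level /=; case: asboolP => // -[].
  by exists y.
rewrite offsetS oS IHl IHo; split=> //; rewrite levelS IHl IHo.
rewrite [RHS]filter_binary_words; last first.
  by move=> s b /asboolP/tree_rcons/asboolP.
rewrite -/(tree_level Q k) -[in RHS](mkseq_nth [::] (tree_level Q k)) -map_comp.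
congr flatten; apply/eq_in_map => i; rewrite mem_iota add0n => /= ltik.
have := mem_nth [::] ltik; set s := nth _ _ _.
rewrite mem_filter => /andP[/asboolP/tree_extend[b sb] _].
have nodeE : tree_node Q (o k + i) = s by exact: (nth_flatten_levels L_gt0 erefl oS).
rewrite /x /code_of_closed nodeE /=.
(* A known child excludes the childless case, which [code_of_closed] would also send to 0. *)
have {sb} : `[< tree_of_closed Q (rcons s b) >] by exact/asboolP.
case: b; case: (asbool _) => //= _; case: (asbool _) => //=;
  by rewrite /branches /= inordK.
Qed.

Lemma branch_set_code Q : closed_hyperspace Q -> branch_set (code_of_closed Q) = Q.
Proof.
move=> hQ; have [clQ _] := hQ; apply/seteqP; split => [y yQ|y Qy k].
  apply: mem_closed_tree => // k; have := yQ k; rewrite level_code// mem_filter.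
  by move=> /andP[/asboolP].
rewrite level_code// mem_filter mem_binary_words size_mkseq eqxx andbT.
by apply/asboolP; exact: tree_mkseq.
Qed.

(** * The hitting events *)

(** The bijection turns the image in [mu_star] into a condition on the sequence itself. *)
Definition hit (Q : set cantor_space) : set ternary_space :=
  [set x | branch_set x `&` Q !=set0].

Lemma image_code_hit Q :
  code_of_closed @` [set K | closed_hyperspace K /\ K `&` Q !=set0] = hit Q.
Proof.
apply/seteqP; split=> [_ [K [hK KQ] <-]|x xQ].
  by rewrite /hit /= branch_set_code.
exists (branch_set x); last exact: code_branch_set.
split=> //; split; first exact: closed_branch_set.
by case: xQ => y [xy _]; exists y.
Qed.

Lemma hit_bigcup I (P : set I) (Q : I -> set cantor_space) :
  hit (\bigcup_(i in P) Q i) = \bigcup_(i in P) hit (Q i).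
Proof.
apply/seteqP; split=> [x [y [xy [i Pi Qy]]]|x [i Pi [y [xy Qy]]]].
  by exists i => //; exists y.
by exists y; split=> //; exists i.
Qed.

(** Compactness provides one point of [branch_set x] common to all the [Q n], from separate points
    for each [n]. *)
Lemma hit_bigcap (Q : nat -> set cantor_space) : (forall n, closed (Q n)) ->
  (forall n, Q n.+1 `<=` Q n) -> hit (\bigcap_n Q n) = \bigcap_n hit (Q n).
Proof.
move=> clQ decQ; apply/seteqP; split=> [x [y [xy Qy]] n _|x xQ].
  by exists y; split=> //; exact: Qy.
have [n|n y [xy /decQ]|n|y yQ] := @cantor_nested (fun n => branch_set x `&` Q n) => //.
- by apply: closedI => //; exact: closed_branch_set.
- exact: (xQ n I).
- by exists y; split=> [|n _]; [case: (yQ 0 I)|case: (yQ n I)].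
Qed.

Definition meets_tree (Q : set cantor_space) (l : seq (seq bool)) :=
  has (fun s => `[< tree_of_closed Q s >]) l.

(** Each set of the intersection depends on finitely many symbols, whence measurability. The common
    nodes of both trees form nested closed conditions on a path, and a path satisfying them all lies
    in both closed sets. *)
Lemma hit_levels Q : closed Q ->
  hit Q = \bigcap_k [set x | meets_tree Q (level x k)].
Proof.
move=> clQ; apply/seteqP; split=> [x [y [xy Qy]] k _|x xQ].
  by apply/hasP; exists (mkseq y k); [exact: xy|apply/asboolP; exact: tree_mkseq].
pose S k := [set s | s \in level x k /\ tree_of_closed Q s].
have [k|k y|k|y yS] := @cantor_nested (fun k => [set y | S k (mkseq y k)]).
- exact: (@closed_prefix bool (S k)).
- by rewrite /S /= mkseqS => -[/level_rcons ? /tree_rcons].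
- have /hasP[s sx /asboolP[y [Qy ys]]] := xQ k I.
  exists y; rewrite /S /=; have <- : s = mkseq y k.
    by rewrite -ys (level_words sx).
  by split=> //; exists y.
exists y; split=> [k|]; first by case: (yS k I).
by apply: mem_closed_tree => // k; case: (yS k I).
Qed.

(** Makes a level a function of a finite word, for use in measurability and in computation. *)
Lemma level_mkseq x k : level x k = level (nth ord0 (mkseq x (2 ^ k))) k.
Proof.
by rewrite /level (@eq_level x (nth ord0 (mkseq x (2 ^ k))))// => i lti;
  rewrite nth_mkseq.
Qed.

Lemma measurable_prefix (S : set (seq 'I_3)) k :
  measurable ([set x | S (mkseq x k)] : set ternary_borel).
Proof. by apply: sub_sigma_algebra; exact: (@open_prefix 'I_3). Qed.

Lemma measurable_level (P : set (seq (seq bool))) k :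
  measurable ([set x | P (level x k)] : set ternary_borel).
Proof.
have := measurable_prefix [set w | P (level (nth ord0 w) k)] (2 ^ k).
by congr measurable; apply/funext => x /=; rewrite -level_mkseq.
Qed.

Lemma measurable_hit Q : closed Q -> measurable (hit Q : set ternary_borel).
Proof.
move=> /hit_levels ->; apply: bigcapT_measurable => k.
exact: (measurable_level (meets_tree Q)).
Qed.

(** * Hitting a clopen set *)

Lemma encode_seq_inj A {cA : coded A} :
  injective (@encode A _) -> injective (@encode (seq A) _).
Proof.
by move=> inj s t /(can_inj CodeSeq.codeK); exact: inj_map.
Qed.

Lemma encode_word_inj : injective (@encode (seq bool) _).
Proof. by apply: encode_seq_inj => -[] []. Qed.

Lemma effective_ord X n {cX : coded X} (f : X -> 'I_n) :
  effective f -> effective (fun x => nat_of_ord (f x)).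
Proof. exact: effective_encode. Qed.

(** Extends the search by the closure lemmas proved so far; equality tests need an injective code,
    supplied here for binary words and for numbers. *)
Ltac eff_step ::= cbv beta; first
  [ exact: effective_id | exact: effective_cst | assumption
  | apply: effective_fst | apply: effective_snd | apply: effective_pair
  | apply: effective_if | apply: effective_cons
  | apply: effective_mul | apply: effective_add
  | apply: effective_expn2 | apply: effective_succ | apply: effective_pred
  | apply: effective_map | apply: effective_filter | apply: effective_has
  | apply: effective_flatten | apply: effective_size
  | apply: effective_foldr
  | apply: effective_rcons | apply: effective_nth | apply: effective_iota
  | apply: effective_ord
  | apply: (effective_eq encode_word_inj) | apply: (@effective_eq _ _ nat _ _ _ (fun _ _ => id))
  | apply: effective_iter ].
Lemma effective_branches X {cX : coded X} (c : X -> 'I_3) (s : X -> seq bool) :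
  effective c -> effective s -> effective (fun x => branches (c x) (s x)).
Proof. by move=> ec es; rewrite /branches; eff. Qed.
Lemma effective_level X {cX : coded X} (w : X -> seq 'I_3) (k : X -> nat) :
  effective w -> effective k ->
  effective (fun x => level (nth ord0 (w x)) (k x)).
Proof.
move=> ew ek; rewrite /level /level_state /level_step.
(* The form in which [w] occurs inside the iteration and the map, left for [assumption]. *)
have ew1 : effective (fun p : X * (nat * seq (seq bool)) * nat => w p.1.1).
  by apply: (effective_comp ew); eff.
eff; apply: effective_branches; eff.
Qed.

(** The prefix test uses [mkseq] and [nth] so that [eff] can handle it. The padding [false] is not
    read when the nodes are at least as long as the words of [l], as at level [depth l]. *)
Definition matches (l : seq (seq bool)) (L : seq (seq bool)) :=
  has (fun s => has (fun t => mkseq (nth false s) (size t) == t) l) L.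

Definition ternary_words (N : nat) : seq (seq 'I_3) :=
  iter N (fun ws => flatten [seq [seq c :: w | c <- enum 'I_3] | w <- ws]) [:: [::]].

(* The sum of the lengths, an upper bound for each of them. *)
Definition depth (l : seq (seq bool)) := foldr (fun t k => size t + k) 0 l.

(** By [level_mkseq], 2 ^ [depth l] symbols determine level [depth l]. *)
Definition hitting_words (l : seq (seq bool)) : seq (seq 'I_3) :=
  [seq w <- ternary_words (2 ^ depth l) | matches l (level (nth ord0 w) (depth l))].

Lemma effective_depth X {cX : coded X} (l : X -> seq (seq bool)) :
  effective l -> effective (fun x => depth (l x)).
Proof. by move=> el; rewrite /depth; eff. Qed.

Lemma effective_matches X {cX : coded X} (l L : X -> seq (seq bool)) :
  effective l -> effective L -> effective (fun x => matches (l x) (L x)).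
Proof.
move=> el eL; rewrite /matches /mkseq; eff.
by apply: (effective_comp el); eff.
Qed.

Lemma effective_hitting_words X {cX : coded X} (l : X -> seq (seq bool)) :
  effective l -> effective (fun x => hitting_words (l x)).
Proof.
move=> el; rewrite /hitting_words /ternary_words.
have ed : effective (fun x => depth (l x)) by exact: effective_depth.
have el1 : effective (fun p : X * seq 'I_3 => l p.1).
  by apply: (effective_comp el); eff.
apply: effective_filter; last by eff.
apply: effective_matches => //; apply: effective_level; first by eff.
exact: effective_depth.
Qed.

Lemma mem_ternary_words N w : (w \in ternary_words N) = (size w == N).
Proof.
elim: N w => [|N IHN] w; first by rewrite inE; case: w.
rewrite /ternary_words iterS -/(ternary_words N).
apply/allpairsPdep/eqP => [[u [c [uN _ ->]]]|].
  by move: uN; rewrite IHN /= => /eqP ->.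
case: w => // c u [] /eqP uN; exists u, c.
by rewrite IHN uN mem_enum.
Qed.

Lemma ternary_words_uniq N : uniq (ternary_words N).
Proof.
elim: N => // N IHN; rewrite /ternary_words iterS -/(ternary_words N).
by apply: allpairs_uniq => //; [exact: enum_uniq|move=> [u c] [v e] _ _ /= [-> ->]].
Qed.

Lemma size_ternary_words N : size (ternary_words N) = 3 ^ N.
Proof.
elim: N => // N IHN; rewrite /ternary_words iterS -/(ternary_words N).
by rewrite size_allpairs IHN size_enum_ord expnSr.
Qed.

Lemma leq_depth l t : t \in l -> size t <= depth l.
Proof.
elim: l => // u l IHl; rewrite inE => /predU1P[->|/IHl]; first exact: leq_addr.
by move/leq_trans; apply; exact: leq_addl.
Qed.

(** A node at level [depth l] is long enough to decide membership in each cylinder, and every node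
    lies on an infinite path by [tree_branch_set]. *)
Lemma hit_clopen_of_name l :
  hit (clopen_of_name l) = [set x | matches l (level x (depth l))].
Proof.
apply/seteqP; split=> [x [y [xy [t /= tl yt]]]|x].
  apply/hasP; exists (mkseq y (depth l)); first exact: xy.
  apply/hasP; exists t => //; apply/eqP; rewrite -[RHS]yt.
  apply/eq_in_map => i; rewrite mem_iota add0n => /= lti.
  by rewrite nth_mkseq// (leq_trans lti)// leq_depth.
move=> /hasP[s sx /hasP[t tl /eqP st]].
have [y [xy ys]] : tree_of_closed (branch_set x) s.
  by apply/tree_branch_set; rewrite (level_words sx).
exists y; split=> //; exists t => //; rewrite /cylinder /= -{2}st.
apply/eq_in_map => i; rewrite mem_iota add0n => /= lti.
by rewrite -ys nth_mkseq// (level_words sx) (leq_trans lti)// leq_depth.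
Qed.

(** * The hitting capacity *)

Local Close Scope nat_scope.

(** Finite additivity over the fibres of [f], applied below to the pattern of events that occur and
    to prefixes of sequences. *)
Lemma measure_fibers d (T : measurableType d) (R : realType)
    (mu : probability T R) (E : eqType) (f : T -> E) (l : seq E) :
  uniq l -> (forall e, measurable (f @^-1` [set e])) ->
  mu [set x | f x \in l] = (\sum_(e <- l) mu (f @^-1` [set e]))%E.
Proof.
move=> + mf.
have consE e (s : seq E) : [set x | f x \in e :: s] = f @^-1` [set e] `|` [set x | f x \in s].
  apply/seteqP; split=> x; first by rewrite /= in_cons => /predU1P.
  by rewrite /= in_cons => fx; apply/predU1P.
have nilE : [set x | f x \in [::]] = set0 by apply/seteqP; split.
have mfl (s : seq E) : measurable [set x | f x \in s].
  elim: s => [|e s IHs]; first by rewrite nilE.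
  by rewrite consE; exact: measurableU.
elim: l => [_|e l IHl /= /andP[el ul]].
  by rewrite big_nil nilE measure0.
rewrite big_cons -IHl// consE measureU//.
by apply/seteqP; split=> x //= [->]; rewrite (negbTE el).
Qed.

(** Expand the product over [i] of 1 - [i in U], which vanishes as soon as [U] has an element. *)
Lemma sum_sign_subset (R : comNzRingType) (I : finType) (U : {set I}) :
  \sum_(J : {set I} | J \subset U) (-1) ^+ #|J| = (U == finset.set0)%:R :> R.
Proof.
transitivity (\prod_i (- (i \in U)%:R + 1 : R)); last first.
  have [->|/finset.set0Pn[i iU]] := eqVneq U finset.set0.
    by rewrite big1// => i _; rewrite inE oppr0 add0r.
  by rewrite (bigD1 i)//= iU addNr mul0r.
rewrite bigA_distr /= big_mkcond /=; apply: eq_bigr => J _.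
rewrite -big_mkcond /=; case: ifPn => [/fintype.subsetP JU|/fintype.subsetPn[i iJ iU]].
  by rewrite -prodr_const; apply: eq_bigr => i /JU ->.
by rewrite (bigD1 i)//= (negbTE iU) oppr0 mul0r.
Qed.

(** Inclusion-exclusion at one point, [s] being the set of events that occur there. All signs
    together sum to 0, so the sets meeting [s] can be traded for the subsets of its complement. *)
Lemma sum_sign_meet (R : comNzRingType) n (s : {set 'I_n}) : (0 < n)%N ->
  \sum_(J : {set 'I_n} | (0 < #|J|)%N && (J :&: s != finset.set0)) (-1) ^+ #|J|.+1
  = (s == [set: 'I_n]%SET)%:R :> R.
Proof.
move=> n_gt0; under eq_bigl => J.
  rewrite andb_idl; last first.
    by rewrite card_gt0; apply: contraNneq => ->; rewrite finset.set0I.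
  over.
have sum0 : \sum_(J : {set 'I_n}) (-1) ^+ #|J| = 0 :> R.
  transitivity (([set: 'I_n]%SET == finset.set0)%:R : R).
    by rewrite -sum_sign_subset; apply: eq_bigl => J; rewrite finset.subsetT.
  case: eqP => // /finset.setP/(_ (Ordinal n_gt0)).
  by rewrite !finset.inE.
move: sum0; rewrite (bigID (fun J : {set 'I_n} => J :&: s != finset.set0)%SET) /= => /eqP.
rewrite addr_eq0 => /eqP E.
under eq_bigr do rewrite exprS mulN1r.
rewrite sumrN E opprK; under eq_bigl do rewrite negbK finset.setI_eq0 finset.disjoints_subset.
by rewrite sum_sign_subset -finset.setCT (inj_eq (@finset.setC_inj _)).
Qed.

(** Partition the space by the set [S x] of events that occur at [x]. Both sides become combinations
    of the masses [m s], and [sum_sign_meet] compares the coefficients. *)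
Lemma inclusion_exclusion d (T : measurableType d) (R : realType)
    (mu : probability T R) n (A : 'I_n -> set T) :
  (0 < n)%N -> (forall i, measurable (A i)) ->
  fine (mu (\bigcap_i A i)) =
  \sum_(J : {set 'I_n} | (0 < #|J|)%N)
    (-1) ^+ #|J|.+1 * fine (mu (\bigcup_(i in [set j | j \in J]) A i)).
Proof.
move=> n_gt0 mA; pose S x := [set i | `[< A i x >]]%SET.
have mS s : measurable (S @^-1` [set s]).
  have -> : S @^-1` [set s] = \bigcap_i (if i \in s then A i else ~` A i).
    apply/seteqP; split=> [x <- i _|x xs].
      by rewrite inE; case: asboolP.
    apply/finset.setP => i; rewrite inE; have := xs i I.
    by case: ifP => _ Aix; apply/asboolP.
  apply: fin_bigcap_measurable => [|i _]; first exact: finite_finset.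
  by case: ifP => _; [|apply: measurableC]; exact: mA.
pose m s := fine (mu (S @^-1` [set s])).
have muS (P : pred {set 'I_n}) : fine (mu [set x | P (S x)]) = \sum_(s | P s) m s.
  have -> : [set x | P (S x)] = [set x | S x \in enum P].
    by apply/funext => x /=; rewrite mem_enum.
  rewrite measure_fibers ?enum_uniq// -big_enum /=.
  rewrite (eq_bigr (fun s => (m s)%:E)) ?sumEFin// => s _.
  by rewrite fineK// fin_num_measure.
have -> : \bigcap_i A i = [set x | S x == [set: 'I_n]%SET].
  apply/seteqP; split=> [x xA|x /eqP xS i _].
    by apply/eqP/finset.setP => i; rewrite !inE; apply/asboolP; exact: xA.
  by have /finset.setP/(_ i) := xS; rewrite !inE => /asboolP.
rewrite (muS (pred1 [set: 'I_n]%SET)) big_pred1_eq.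
under eq_bigr => J _.
  have -> : \bigcup_(i in [set j | j \in J]) A i = [set x | J :&: S x != finset.set0].
    apply/seteqP; split=> [x [i iJ Aix]|x /finset.set0Pn[i]].
      by apply/finset.set0Pn; exists i; rewrite !inE [_ \in _]iJ; apply/asboolP.
    by rewrite !inE => /andP[iJ /asboolP Aix]; exists i.
  rewrite (muS (fun s => J :&: s != finset.set0)) mulr_sumr.
  over.
rewrite (exchange_big_dep xpredT)//= (bigD1 [set: 'I_n]%SET)//= [X in _ + X]big1 ?addr0.
  by rewrite -mulr_suml sum_sign_meet// eqxx mul1r.
by move=> s sT; rewrite -mulr_suml sum_sign_meet// (negbTE sT) mul0r.
Qed.

Section HittingCapacity.
Context (R : realType) (mu : probability ternary_borel R).

Lemma hitting_capacityE Q : hitting_capacity mu Q = fine (mu (hit Q)).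
Proof. by rewrite /hitting_capacity /mu_star image_code_hit. Qed.

Lemma le_hitting_capacity Q1 Q2 : closed Q1 -> closed Q2 -> Q1 `<=` Q2 ->
  hitting_capacity mu Q1 <= hitting_capacity mu Q2.
Proof.
move=> /measurable_hit m1 /measurable_hit m2 Q12; rewrite !hitting_capacityE.
rewrite fine_le ?fin_num_measure// le_measure ?inE//.
by move=> x [y [xy /Q12 Qy]]; exists y.
Qed.

Lemma hitting_capacity_itv Q : closed Q -> 0 <= hitting_capacity mu Q <= 1.
Proof.
move=> /measurable_hit mQ; rewrite hitting_capacityE fine_ge0//=.
by rewrite -lee_fin fineK ?fin_num_measure// probability_le1.
Qed.

Lemma hitting_capacity_is_capacity : is_capacity (hitting_capacity mu).
Proof.
split.
- exact: hitting_capacity_itv.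
- rewrite hitting_capacityE (_ : hit set0 = set0) ?measure0//.
  by apply/seteqP; split=> x // [y []].
- exact: le_hitting_capacity.
- move=> n Q n_ge2 clQ.
  under eq_bigr do rewrite hitting_capacityE hit_bigcup.
  (* The alternating sum is exactly the probability of hitting every [Q i], possibly at different
     points. *)
  rewrite -inclusion_exclusion ?(ltnW n_ge2)//; last first.
    by move=> i; exact: measurable_hit.
  have mI : measurable (\bigcap_i hit (Q i) : set ternary_borel).
    apply: fin_bigcap_measurable => [|i _]; first exact: finite_finset.
    exact: measurable_hit.
  have mQ : measurable (hit (\bigcap_i Q i) : set ternary_borel).
    by apply: measurable_hit; apply: closed_bigI => i _; exact: clQ.
  rewrite hitting_capacityE fine_le ?fin_num_measure// le_measure ?inE//.
  by move=> x [y [xy Qy]] i _; exists y; split=> //; exact: Qy.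
- move=> Q clQ decQ; rewrite hitting_capacityE hit_bigcap//.
  under eq_fun do rewrite hitting_capacityE.
  apply: fine_cvg; rewrite fineK; last first.
    by rewrite fin_num_measure//; apply: bigcapT_measurable => n; exact: measurable_hit.
  apply: nonincreasing_cvg_mu.
  + by rewrite ltey_eq fin_num_measure//; exact: measurable_hit.
  + by move=> n; exact: measurable_hit.
  + by apply: bigcapT_measurable => n; exact: measurable_hit.
  + apply/nonincreasing_seqP => n; rewrite subsetEset => x [y [xy /decQ Qy]].
    by exists y.
Qed.
End HittingCapacity.

(** * Computing the capacity of a clopen set *)

Lemma hitting_capacity_clopen (R : realType) (d : seq 'I_3 -> R)
    (mu : probability ternary_borel R) (l : seq (seq bool)) :
  (forall s, mu (cylinder s) = (d s)%:E) ->
  hitting_capacity mu (clopen_of_name l) = \sum_(w <- hitting_words l) d w.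
Proof.
move=> muE; rewrite hitting_capacityE hit_clopen_of_name; set N := (2 ^ depth l)%N.
have -> : [set x | matches l (level x (depth l))] =
    [set x : ternary_space | mkseq x N \in hitting_words l].
  apply/funext => x /=; rewrite mem_filter mem_ternary_words size_mkseq eqxx andbT.
  by rewrite level_mkseq.
rewrite (@measure_fibers _ _ _ mu _ (fun x : ternary_borel => mkseq x N)); first last.
- by move=> s; exact: (measurable_prefix [set s]).
- exact/filter_uniq/ternary_words_uniq.
rewrite (eq_big_seq (fun w => (d w)%:E)) ?sumEFin// => w.
rewrite mem_filter mem_ternary_words => /andP[_ /eqP wN].
by rewrite -muE /cylinder wN.
Qed.

(* [(p, q, r)] stands for the rational [(p - q) / (r + 1)]. *)
Definition frac_val (R : realType) (a : nat * nat * nat) : R :=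
  (a.1.1%:R - a.1.2%:R) / a.2.+1%:R.

Definition frac_add (a b : nat * nat * nat) : nat * nat * nat :=
  (a.1.1 * b.2.+1 + b.1.1 * a.2.+1, a.1.2 * b.2.+1 + b.1.2 * a.2.+1,
   (a.2.+1 * b.2.+1).-1)%N.

Lemma frac_addE (R : realType) a b :
  frac_val R (frac_add a b) = frac_val R a + frac_val R b.
Proof.
(* Denominators are stored minus one; their product is positive, so the successor undoes the
   predecessor. *)
have rE : (frac_add a b).2.+1%N = (a.2.+1 * b.2.+1)%N by [].
rewrite /frac_val rE /frac_add /= !natrD !natrM.
have nz m : m.+1%:R != 0 :> R by rewrite pnatr_eq0.
by move: (nz a.2) (nz b.2); move: (_.+1%:R) (_.+1%:R) => u v u0 v0; field; rewrite u0 v0.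
Qed.

Definition frac_sum (f : seq 'I_3 -> nat * nat * nat) (ws : seq (seq 'I_3)) :=
  foldr (fun w => frac_add (f w)) (0, 0, 0)%N ws.

Lemma frac_sumE (R : realType) f ws :
  frac_val R (frac_sum f ws) = \sum_(w <- ws) frac_val R (f w).
Proof.
elim: ws => [|w ws IHws]; first by rewrite big_nil /frac_val /= subrr mul0r.
by rewrite big_cons /= frac_addE IHws.
Qed.

(* There are at most 3^N <= 2^(2N) summands, with N = 2 ^ depth l, so precision
   n + 2N for each of them gives precision n for the sum. *)
Definition precision (l : seq (seq bool)) (n : nat) := (n + 2 ^ depth l + 2 ^ depth l)%N.

Definition capacity_approx (p q r : 2.-tuple nat -> nat) (l : seq (seq bool))
    (n : nat) : nat * nat * nat :=
  frac_sum (fun w => let v := [tuple code_ternary_word w; precision l n] in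
    (p v, q v, r v)) (hitting_words l).

Lemma capacity_approxP (R : realType) (d : seq 'I_3 -> R) p q r l n :
  (forall (w : seq 'I_3) (n : nat), let v := [tuple code_ternary_word w; n] in
     `|d w - ((p v)%:R - (q v)%:R) / (r v).+1%:R| <= 2 ^- n) ->
  `|\sum_(w <- hitting_words l) d w - frac_val R (capacity_approx p q r l n)|
    <= 2 ^- n.
Proof.
move=> dE; rewrite frac_sumE -sumrB (le_trans (ler_norm_sum _ _ _))//.
set N := (2 ^ depth l)%N; set k := precision l n.
apply: (@le_trans _ _ (\sum_(w <- hitting_words l) 2 ^- k)).
  by apply: ler_sum => w _; exact: dE.
rewrite big_const_seq count_predT iter_addr_0 -[_ *+ _]mulr_natl.
have szw : (size (hitting_words l) <= 2 ^ (N + N))%N.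
  rewrite size_filter (leq_trans (count_size _ _))// size_ternary_words.
  by rewrite addnn -mul2n expnM leq_exp2r// expn_gt0.
rewrite ler_pdivrMr ?exprn_gt0// /k /precision -addnA exprD mulrA mulVf; last first.
  by rewrite expf_neq0// pnatr_eq0.
by rewrite mul1r -natrX ler_nat.
Qed.

Lemma effective_frac_add X {cX : coded X} (a b : X -> nat * nat * nat) :
  effective a -> effective b -> effective (fun x => frac_add (a x) (b x)).
Proof. by move=> ea eb; rewrite /frac_add; eff. Qed.

Lemma effective_precision X {cX : coded X} (l : X -> seq (seq bool)) (n : X -> nat) :
  effective l -> effective n -> effective (fun x => precision (l x) (n x)).
Proof.
move=> el en; have ed := effective_depth el.
by rewrite /precision; eff.
Qed.

Lemma effective_capacity_approx p q r :
  recursive_fun p -> recursive_fun q -> recursive_fun r ->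
  effective (fun z : seq (seq bool) * nat => capacity_approx p q r z.1 z.2).
Proof.
move=> rp rq rr; rewrite /capacity_approx /frac_sum.
have eh : effective (fun z : seq (seq bool) * nat => hitting_words z.1).
  by apply: effective_hitting_words; eff.
apply: effective_foldr => //; last exact: effective_cst.
pose Z := (seq (seq bool) * nat * seq 'I_3 * (nat * nat * nat))%type.
have ec : effective (fun z : Z => code_ternary_word z.1.2).
  by apply: (@effective_encode Z (seq 'I_3)); eff.
have ep : effective (fun z : Z => precision z.1.1.1 z.1.1.2).
  by apply: effective_precision; eff.
apply: effective_frac_add; last by eff.
by apply: effective_pair; [apply: effective_pair|]; exact: effective_recursive_fun.
Qed.

Lemma computable_hitting_capacity (R : realType) (d : seq 'I_3 -> R)
    (mu : probability ternary_borel R) :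
  (forall s, mu (cylinder s) = (d s)%:E) ->
  computable_real_fun code_ternary_word d ->
  computable_real_fun code_clopen_name (hitting_capacity mu \o clopen_of_name).
Proof.
move=> muE [p [q [r [rp rq rr dE]]]].
have eA := effective_capacity_approx rp rq rr.
(* The approximation is one effective triple; numerator parts and denominator are projections of
   it. *)
have lift3 (g : nat * nat * nat -> nat) : effective g -> exists2 G : 2.-tuple nat -> nat,
    recursive_fun G & forall l n,
      G [tuple code_clopen_name l; n] = g (capacity_approx p q r l n).
  move=> eg; have [G rG GE] := effective_comp eg eA.
  exists (fun v => G (code_pair (tnth v ord0) (tnth v (lift ord0 ord0)))) => [|l n].
    by apply: recursive_comp1 rG _; apply: recursive_pair; exact: rec_proj.
  by rewrite tnth0 tnthS tnth0; exact: (GE (l, n)).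
have e1 : effective (fun a : nat * nat * nat => a.1.1) by eff.
have e2 : effective (fun a : nat * nat * nat => a.1.2) by eff.
have e3 : effective (fun a : nat * nat * nat => a.2) by eff.
have [p' rp' p'E] := lift3 _ e1.
have [q' rq' q'E] := lift3 _ e2.
have [r' rr' r'E] := lift3 _ e3.
exists p', q', r'; split=> // l n; cbv zeta; rewrite p'E q'E r'E /=.
by rewrite (hitting_capacity_clopen _ muE); exact: capacity_approxP.
Qed.

Theorem theorem4 (R : realType) (d : seq 'I_3 -> R)
    (d_itv : forall s : seq 'I_3, 0 <= d s <= 1)
    (d_nil : d [::] = 1)
    (d_split : forall s : seq 'I_3, d s = \sum_(i < 3) d (rcons s i))
    (mu_d : probability ternary_borel R)
    (mu_dE : forall s : seq 'I_3, mu_d (cylinder s) = (d s)%:E) :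
  is_capacity (hitting_capacity mu_d) /\
  (computable_real_fun code_ternary_word d ->
   is_computable_capacity (hitting_capacity mu_d)).
Proof.
split=> [|d_comp]; first exact: hitting_capacity_is_capacity.
split; first exact: hitting_capacity_is_capacity.
(* The capacity is its own [F]: computability concerns only its values on names of clopen sets. *)
exists (hitting_capacity mu_d); split=> // [B [_ clB]|].
  exact: hitting_capacity_itv.
exact: computable_hitting_capacity mu_dE d_comp.
Qed.
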